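(* Let $(\alpha,\beta)$ be a pair of real-valued random variables such that $\mathbb{P}(\alpha\ne0)=1$, $\mathbb{P}(|\alpha|\ne1)>0$, and there is no constant $c\in\mathbb{R}$ with $\alpha(c-\beta)=c$ almost surely. Assume that for each $a\in\mathbb{R}$ in the support of the random variable $\alpha$ there exists the conditional density function $f_\beta(t\,|\,a)=\mathbb{P}(\beta\in\mathrm{d}t\,|\,\alpha=a)/\mathrm{d}t$ of $\beta$ given $\alpha=a$. Then any bounded function $y:\mathbb{R}\to\mathbb{R}$ satisfying $$y(x)=\mathbb{E}\{y(\alpha(x-\beta))\}\qquad\text{for all }x\in\mathbb{R}$$ is uniformly continuous on $\mathbb{R}$.
   Context: $\mathbb{E}$ denotes expectation with respect to the joint distribution of $(\alpha,\beta)$. The density hypothesis means that, with $\mu_\alpha$ the distribution of $\alpha$, the joint law of $(\alpha,\beta)$ disintegrates as $\mu_\alpha(\mathrm{d}a)\,f_\beta(t\,|\,a)\,\mathrm{d}t$, where $f_\beta(\cdot\,|\,a)$ is a probability density on $\mathbb{R}$ with respect to Lebesgue measure for each $a$ in the support of $\alpha$, and $(a,t)\mapsto f_\beta(t\,|\,a)$ is jointly measurable. The function $y$ is assumed Borel measurable so that the expectation makes sense; continuity of $y$ is not assumed a priori. No restriction is placed on $\mathbb{E}\{\ln|\alpha|\}$. *)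

(* Defs.v *)
From mathcomp Require Import all_boot all_order all_algebra.
From mathcomp Require Import all_classical all_reals all_analysis.
Set Implicit Arguments.
Unset Strict Implicit.
Unset Printing Implicit Defensive.
Import Order.TTheory GRing.Theory Num.Theory.
Import numFieldNormedType.Exports.

Local Open Scope classical_set_scope.
Local Open Scope ring_scope.
Local Open Scope ereal_scope.

(* The (closed, topological) support of a random variable. *)
Definition rv_support d (T : measurableType d) (R : realType)
    (P : probability T R) (X : {RV P >-> R}) : set R :=
  [set a | forall U : set R, open U -> U a -> 0 < distribution P X U].

Definition probability_density (R : realType) (g : R -> R) : Prop :=
  [/\ measurable_fun [set: R] g,
      forall t, (0 <= g t)%R
    & \int[lebesgue_measure]_t (g t)%:E = 1].

(* [f a t] stands for f_beta(t | a); its values for [a] outside the support of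
   [alpha] are irrelevant. The last clause says that the joint law of
   (alpha, beta) is mu_alpha(da) f(t | a) dt. *)
Definition conditional_density d (T : measurableType d) (R : realType)
    (P : probability T R) (alpha beta : {RV P >-> R}) (f : R -> R -> R) : Prop :=
  [/\ measurable_fun (rv_support alpha `*` [set: R])
        (fun p : R * R => f p.1 p.2),
      forall a, rv_support alpha a -> probability_density (f a)
    & forall A : set (R * R), measurable A ->
        P [set w | A (alpha w, beta w)] =
        \int[distribution P alpha]_(a in rv_support alpha)
          \int[lebesgue_measure]_(t in xsection A a) (f a t)%:E].

(* Main.v *)
(* Disintegrating, y(x) is the mean over a of the convolution of f(. | a) with
   the bounded function t |-> y(a t).  Moving a shift of x onto the density gives
   |y(x + c) - y(x)| <= 2 M * E_a || f(. + c | a) - f(. | a) ||_1, a bound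
   independent of x, which tends to 0 with c by continuity of translations in L^1
   and dominated convergence over a. *)
From HB Require Import structures.
Require Import Defs.
From mathcomp Require Import all_boot all_order all_algebra.
From mathcomp Require Import all_classical all_reals all_analysis.
From mathcomp Require Import measurable_realfun ring lra.
Import Order.TTheory GRing.Theory Num.Theory.
Import numFieldNormedType.Exports.
Local Open Scope classical_set_scope.
Local Open Scope ring_scope.

(** * Integration against a measure given by a density *)

Section integral_density.
Import HBNNSimple.

(** By monotone convergence both sides are limits along the increasing simple approximations [h n]
    of [f]. Linearity then reduces the claim to indicators of level sets, where it is the hypothesis
    relating [nu] to [mu]. *)
Lemma ge0_integral_density {d : measure_display} {T : measurableType d}
    {R : realType} (mu nu : {measure set T -> \bar R}) (g : T -> R)
    (f : T -> \bar R) :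
  measurable_fun [set: T] g -> (forall x, 0 <= g x) ->
  (forall A, measurable A -> nu A = (\int[mu]_(x in A) (g x)%:E)%E) ->
  measurable_fun [set: T] f -> (forall x, (0 <= f x)%E) ->
  (\int[nu]_x f x = \int[mu]_x (f x * (g x)%:E))%E.
Proof.
move=> mg g0 nuE mf f0.
have mgE : measurable_fun [set: T] (EFin \o g) by exact/measurable_EFinP.
pose h := nnsfun_approx measurableT mf.
have hcvg x : EFin \o h ^~ x @ \oo --> f x.
  by apply: cvg_nnsfun_approx.
have hnd x : {homo (fun n => h n x) : m n / (m <= n)%N >-> m <= n}.
  by move=> m n mn; exact/lefP/nd_nnsfun_approx.
have mh n : measurable_fun [set: T] (EFin \o h n) by exact/measurable_EFinP.
have -> : (\int[nu]_x f x = lim (\int[nu]_x (h n x)%:E @[n --> \oo]))%E.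
  rewrite -monotone_convergence//.
  - by apply: eq_integral => x _; apply/esym/cvg_lim => //; exact: hcvg.
  - by move=> n x _; rewrite lee_fin.
  - by move=> x _ m n mn; rewrite lee_fin hnd.
have -> : (\int[mu]_x (f x * (g x)%:E) =
    lim (\int[mu]_x ((h n x)%:E * (g x)%:E) @[n --> \oo]))%E.
  rewrite -monotone_convergence//.
  - apply: eq_integral => x _; apply/esym/cvg_lim => //.
    by apply: cvgeZr => //; exact: hcvg.
  - by move=> n; apply: emeasurable_funM => //; exact: mh.
  - by move=> n x _; rewrite -EFinM lee_fin mulr_ge0.
  - by move=> x _ m n mn; rewrite -!EFinM lee_fin ler_wpM2r// hnd.
(* The two sequences agree term by term: for fixed [n], [h n] is expanded as a finite sum of its
   values [r] times indicators of the sets where they are taken. *)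
apply: congr_lim; apply/funext => n /=.
have ind0 r x : (0 <= (r * \1_(h n @^-1` [set r]) x)%:E)%E.
  by rewrite lee_fin; exact: nnfun_muleindic_ge0.
have mind r : measurable_fun [set: T] (fun x => (r * \1_(h n @^-1` [set r]) x)%:E).
  by apply/measurable_EFinP; exact: measurable_funM.
have hE x : (h n x)%:E =
    (\sum_(r \in range (h n)) (r * \1_(h n @^-1` [set r]) x)%:E)%E.
  by rewrite fimfunE -fsumEFin.
under eq_integral do rewrite hE.
under [in RHS]eq_integral do rewrite hE ge0_mule_fsuml//.
rewrite !ge0_integral_fsum//; last 2 first.
- by move=> r; exact: emeasurable_funM.
- by move=> r x _; rewrite mule_ge0// lee_fin.
apply: eq_fsbigr => r rh.
have r0 : 0 <= r by move: rh; rewrite inE => -[t _ <-].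
have mA : measurable (h n @^-1` [set r]) by [].
under eq_integral do rewrite EFinM.
rewrite ge0_integralZl//; last exact/measurable_EFinP.
rewrite integral_indic// setIT nuE//.
under [in RHS]eq_integral do rewrite EFinM -muleA.
rewrite ge0_integralZl//; last 2 first.
- by apply: emeasurable_funM => //; exact/measurable_EFinP.
- by move=> x _; rewrite -EFinM lee_fin mulr_ge0.
congr (_ * _)%E; rewrite integral_mkcond; apply: eq_integral => x _.
by rewrite epatch_indic muleC.
Qed.

End integral_density.

(** * Translation invariance of Lebesgue measure *)

(** Uniqueness of Lebesgue measure: the pushforward [nu] under the translation [phi] gives every
    half-open interval its length. *)
Lemma lebesgue_measure_shift {R : realType} (c : R) (A : set R) :
  measurable A -> lebesgue_measure ((fun t => t + c) @^-1` A) = lebesgue_measure A.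
Proof.
pose phi : measurableTypeR R -> measurableTypeR R := fun t => t + c.
have mphi : measurable_fun [set: measurableTypeR R] phi.
  by apply: measurable_funD.
pose nu : {measure set (measurableTypeR R) -> \bar R} :=
  measure_function_pushforward__canonical__measure_function_Measure
    (@lebesgue_measure R) mphi.
move=> mA; apply/esym/(@lebesgue_measure_unique R nu) => // X [[a b] ab <-].
rewrite /nu/= /pushforward.
have -> : phi @^-1` `]a, b] = `](a - c), (b - c)]%classic.
  by apply/seteqP; split => t /=; rewrite !in_itv/= /phi ltrBlDr lerBrDr.
rewrite !lebesgue_measure_itv/= !lte_fin ltrD2r; case: ifP => // _.
by rewrite -!EFinD; congr EFin; lra.
Qed.

Lemma ge0_integral_shift {R : realType} (c : R) (f : R -> \bar R) :
  measurable_fun [set: R] f -> (forall t, (0 <= f t)%E) ->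
  (\int[@lebesgue_measure R]_t f (t + c)%R = \int[@lebesgue_measure R]_t f t)%E.
Proof.
move=> mf f0.
pose phi : measurableTypeR R -> measurableTypeR R := fun t => t + c.
have mphi : measurable_fun [set: measurableTypeR R] phi.
  by apply: measurable_funD.
have := @ge0_integral_pushforward _ _ _ _ R phi mphi (@lebesgue_measure R)
  setT f measurableT mf (fun t _ => f0 t).
rewrite preimage_setT => <-.
apply: eq_measure_integral => A mA _.
exact: lebesgue_measure_shift.
Qed.

(** * Continuity of translations in $L^1$ *)

Lemma cvge_to0P {R : realType} (u : (\bar R)^nat) : (forall n, (0 <= u n)%E) ->
  (u @ \oo --> 0%E <->
   forall e : R, 0 < e -> \forall n \near \oo, (u n <= e%:E)%E).
Proof.
move=> u0; split=> [/fine_cvgP[ufin /cvgrPdist_le uc] e e0|uc].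
  near=> n; rewrite -(@fineK _ (u n)); last by near: n.
  rewrite lee_fin (le_trans (ler_norm _))// -normrN -sub0r.
  by near: n; exact: uc.
have ufin : \forall n \near \oo, u n \is a fin_num.
  near=> n; rewrite ge0_fin_numE//.
  by rewrite (@le_lt_trans _ _ 1%:E) ?ltry//; near: n; exact: uc.
apply/fine_cvgP; split => //; apply/cvgrPdist_le => e e0.
near=> n; rewrite sub0r normrN ger0_norm ?fine_ge0//= -lee_fin fineK;
  last by near: n.
by near: n; exact: uc.
Unshelve. all: by end_near. Qed.

Lemma measurable_shift {R : realType} (c : R) :
  measurable_fun [set: R] (fun t => t + c).
Proof. exact: measurable_funD. Qed.

Lemma measurable_abs_diff {d : measure_display} {T : measurableType d}
    {R : realType} (f g : T -> R) :
  measurable_fun [set: T] f -> measurable_fun [set: T] g ->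
  measurable_fun [set: T] (fun t => `|(f t - g t)%:E|%E).
Proof.
move=> mf mg; apply: measurableT_comp => //; apply/measurable_EFinP.
exact: measurable_funB.
Qed.

Lemma measurable_translation_diff {R : realType} (g : R -> R) (c : R) :
  measurable_fun [set: R] g ->
  measurable_fun [set: R] (fun t => `|(g (t + c) - g t)%:E|%E).
Proof.
move=> mg; apply: measurable_abs_diff => //.
by apply: (measurableT_comp mg); exact: measurable_shift.
Qed.

(** Pointwise convergence comes from continuity of [k]. As [h] is bounded, all the differences live
    on one bounded interval, so a constant multiple of its indicator dominates them. *)
Lemma cvg_translation_compact_support {R : realType} (k : R -> R) (b : R)
    (h : R^nat) :
  continuous k -> (forall t, b < `|t| -> k t = 0) -> h @ \oo --> 0 ->
  (\int[@lebesgue_measure R]_t `|(k (t + h n) - k t)%:E| @[n --> \oo] --> 0)%E.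
Proof.
move=> ck k0 h0.
have mk : measurable_fun [set: R] k by exact: continuous_measurable_fun.
have [B hB] : exists B, forall n, `|h n| <= B.
  have /cvg_seq_bounded [B [_ hB]] : cvgn h by exact: cvgP h0.
  by exists (B + 1) => n; apply: hB => //; rewrite ltrDl.
have [C kC] : exists C, forall t, `|k t| <= C.
  have cptb : compact `[- b, b] by exact: segment_compact.
  have ckb : {within `[- b, b], continuous k} by exact: continuous_subspaceT.
  have [C [_ kC]] := compact_bounded (continuous_compact ckb cptb).
  (* Boundedness on the compact image holds for every constant above [C], whence [C + 1]; the
     maximum with 0 covers the points where [k] vanishes. *)
  exists (Num.max 0 (C + 1)) => t; rewrite le_max.
  have [tb|bt] := leP `|t| b; last by rewrite k0// normr0 lexx.
  apply/orP; right; apply: kC; first by rewrite ltrDl.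
  by exists t => //=; rewrite in_itv/= -ler_norml.
(* Outside [D] one has [|t| > b + B], hence [|t + h n| > b] as well, so both terms of the difference
   vanish. *)
pose D := (`[- (b + B), b + B]%classic : set R).
have mD : measurable D by exact: measurable_itv.
pose dom := fun t => ((C + C) * \1_D t)%:E.
have idom : (@lebesgue_measure R).-integrable [set: R] dom.
  have -> : dom = (fun t => (C + C)%:E * (\1_D t)%:E)%E by [].
  apply: integrableZl => //.
  exact: integrable_indic_itv.
have [] := @dominated_convergence _ _ _ (@lebesgue_measure R) setT measurableT
  (fun n t => `|(k (t + h n) - k t)%:E|%E) (cst 0%E) dom.
- by move=> n; exact: measurable_translation_diff.
- exact: measurable_cst.
- apply: aeW => t _; rewrite -[0%E]/((0 : R)%:E).
  apply: cvg_EFin; first exact: nearW.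
  apply/norm_cvg0P; apply/subr_cvg0.
  apply: (@cvg_comp _ _ _ (fun n => t + h n) k _ (nbhs t)); last exact: ck.
  have : t + h n @[n --> \oo] --> t + 0 by apply: cvgD => //; exact: cvg_cst.
  by rewrite addr0.
- exact: idom.
- apply: aeW => t n _; rewrite abse_id /dom/= lee_fin.
  rewrite (le_trans (ler_normB _ _))//.
  have [tD|tD] := boolP (t \in D).
    by rewrite indicE tD mulr1 lerD.
  rewrite indicE (negbTE tD) mulr0.
  have : b + B < `|t|.
    rewrite ltNge; apply: contra tD => tb; rewrite inE /D/= in_itv/=.
    by rewrite -ler_norml.
  move=> btB; have := hB n; have := ler_normB (t + h n) (h n).
  rewrite addrK => ? ?; have B0 : 0 <= B by rewrite (le_trans _ (hB 0%N)).
  by rewrite !k0 ?normr0 ?addr0//; lra.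
- by move=> _ _; rewrite integral0.
Qed.

(** A continuous cutoff: a plateau of height 1 on $[-n, n]$, descending linearly to 0 at
    $\pm(n+1)$. *)
Definition tent {R : realType} (n : nat) (t : R) : R :=
  Num.max 0 (Num.min 1 (n.+1%:R - `|t|)).

Lemma continuous_tent {R : realType} (n : nat) : continuous (@tent R n).
Proof.
move=> t; pose b : R -> R := fun t => n.+1%:R - `|t|.
apply: (@continuous_max _ _ (cst 0) (cst 1 \min b)); first exact: cvg_cst.
apply: (@continuous_min _ _ (cst 1) b); first exact: cvg_cst.
by apply: cvgB; [exact: cvg_cst|exact: norm_continuous].
Qed.

Lemma tent_ge0 {R : realType} n (t : R) : 0 <= tent n t.
Proof. by rewrite /tent le_max lexx. Qed.

Lemma tent_le1 {R : realType} n (t : R) : tent n t <= 1.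
Proof. by rewrite /tent ge_max ler01 ge_min lexx. Qed.

Lemma tent_eq0 {R : realType} n (t : R) : n.+1%:R < `|t| -> tent n t = 0.
Proof.
move=> nt; apply/eqP; rewrite eq_le tent_ge0 andbT /tent ge_max lexx /=.
by rewrite ge_min subr_le0 (ltW nt) orbT.
Qed.

Lemma tent_eq1 {R : realType} n (t : R) : `|t| <= n%:R -> tent n t = 1.
Proof.
move=> tn; rewrite /tent min_l; first by rewrite max_r.
by rewrite lerBrDr -natr1 addrC lerD2r.
Qed.

(** Half of [e] pays for cutting [g] off by [tent n], the other half for replacing [g] by a
    continuous [c] on the bounded interval that carries the cutoff. Since the cutoff is at most 1,
    it does not enlarge the second error. *)
Lemma approximation_compact_support {R : realType} (g : R -> R) (e : R) :
  (@lebesgue_measure R).-integrable [set: R] (EFin \o g) -> 0 < e ->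
  exists k : R -> R, [/\ continuous k,
    exists b, forall t, b < `|t| -> k t = 0 &
    (\int[@lebesgue_measure R]_t `|(g t - k t)%:E| <= e%:E)%E].
Proof.
move=> ig e0.
have mg : measurable_fun [set: R] g by case/integrableP : ig => /measurable_EFinP.
have mtent n : measurable_fun [set: R] (@tent R n).
  by apply: continuous_measurable_fun; exact: continuous_tent.
have e20 : 0 < e / 2 by rewrite divr_gt0.
have [n gn] : exists n,
    (\int[@lebesgue_measure R]_t `|(g t - g t * tent n t)%:E| <= (e / 2)%:E)%E.
  have [] := @dominated_convergence _ _ _ (@lebesgue_measure R) setT measurableT
    (fun n t => (g t * tent n t)%:E) (EFin \o g) (fun t => `|(g t)%:E|%E).
  - by move=> n; apply/measurable_EFinP; apply: measurable_funM => //; exact: mtent.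
  - exact/measurable_EFinP.
  (* At a fixed [t] the sequence is constant as soon as [n] reaches [|t|]. *)
  - apply: aeW => t _; apply: cvg_near_cst; near=> n.
    rewrite /= tent_eq1 ?mulr1//; near: n.
    exact: nbhs_infty_ger.
  - exact: integrable_abse.
  - apply: aeW => t n _; rewrite lee_fin normrM ler_piMr//.
    by rewrite ger0_norm ?tent_le1// tent_ge0.
  move=> _ + _; rewrite cvge_to0P; last by move=> n; exact: integral_ge0.
  move=> /(_ _ e20)[n _ /(_ n (leqnn n)) /=] gn; exists n.
  apply: le_trans gn; rewrite le_eqVlt; apply/orP; left; apply/eqP.
  by apply: eq_integral => t _; rewrite /= distrC.
pose D := (`[- n.+1%:R, n.+1%:R]%classic : set R).
have mD : measurable D by exact: measurable_itv.
have Dfin : (@lebesgue_measure R D < +oo)%E.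
  by rewrite lebesgue_measure_itv /=; case: ifP => // _; rewrite -EFinB ltry.
have igD : (@lebesgue_measure R).-integrable D (EFin \o g) by exact: integrableS ig.
have [c_ [cc _ +]] := approximation_continuous_integrable mD Dfin igD.
rewrite cvge_to0P; last by move=> m; exact: integral_ge0.
move=> /(_ _ e20)[m _ /(_ m (leqnn m)) /=].
set c := c_ m => gc.
have mc : measurable_fun [set: R] c by apply: continuous_measurable_fun; exact: cc.
(* The approximation of [g] by [c] is controlled only on [D]; the factor [tent n] vanishes off
   [D]. *)
exists (fun t => c t * tent n t); split.
- by move=> t; apply: cvgM; [exact: cc|exact: continuous_tent].
- by exists n.+1%:R => t nt; rewrite tent_eq0// mulr0.
have mgn : measurable_fun [set: R] (fun t => `|(g t - g t * tent n t)%:E|%E).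
  apply: measurable_abs_diff => //; exact: measurable_funM (mtent n).
have mgcD : measurable_fun [set: R] ((fun t => `|(g t - c t)%:E|%E) \_ D).
  apply: (measurable_restrictT _ mD).1; apply: measurable_funTS.
  exact: measurable_abs_diff.
rewrite [leRHS](_ : _ = (e / 2)%:E + (e / 2)%:E)%E; last by rewrite -EFinD -splitr.
apply: le_trans (leeD gn gc); rewrite [X in (_ <= _ + X)%E]integral_mkcond.
rewrite -ge0_integralD//; last by move=> t _; rewrite patchE; case: ifP.
apply: ge0_le_integral => //.
- apply: measurable_abs_diff => //; apply: measurable_funM => //.
  exact: mtent.
- exact: emeasurable_funD.
(* On [D] this is the triangle inequality through [g t * tent n t]; off [D] both cutoff terms are 0
   and the two sides coincide. *)
move=> t _; rewrite patchE; case: ifPn => tD.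
  rewrite !abse_EFin -EFinD lee_fin.
  rewrite (le_trans (ler_distD (g t * tent n t) _ _))// lerD2l.
  by rewrite -mulrBl normrM ler_piMr// ger0_norm ?tent_le1// tent_ge0.
rewrite tent_eq0 ?mulr0 ?adde0// ltNge; apply: contra tD => tn.
by rewrite inE /D/= in_itv/= -ler_norml.
Unshelve. all: by end_near. Qed.

(** A three-term estimate through a compactly supported continuous [k] close to [g]: the errors of
    [g] against [k] at [t + h n] and at [t] have the same integral by translation invariance, and
    the middle term is the shift of [k]. *)
Lemma cvg_translation_L1 {R : realType} (g : R -> R) (h : R^nat) :
  (@lebesgue_measure R).-integrable [set: R] (EFin \o g) -> h @ \oo --> 0 ->
  (\int[@lebesgue_measure R]_t `|(g (t + h n) - g t)%:E| @[n --> \oo] --> 0)%E.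
Proof.
move=> ig h0; apply/cvge_to0P => [n|e e0]; first exact: integral_ge0.
have mg : measurable_fun [set: R] g by case/integrableP : ig => /measurable_EFinP.
have e30 : 0 < e / 3 by rewrite divr_gt0.
have [k [ck [b k0] gk]] := approximation_compact_support g _ ig e30.
have mk : measurable_fun [set: R] k by exact: continuous_measurable_fun.
have := cvg_translation_compact_support k b h ck k0 h0.
rewrite cvge_to0P => [/(_ _ e30) kh|n]; last exact: integral_ge0.
near=> n.
have kn : (\int[@lebesgue_measure R]_t `|(k (t + h n) - k t)%:E| <= (e / 3)%:E)%E.
  by near: n; exact: kh.
pose gk' := fun t => `|(g t - k t)%:E|%E.
have gk'0 t : (0 <= gk' t)%E by exact: abse_ge0.
have mgk : measurable_fun [set: R] gk'.
  by apply: measurableT_comp => //; apply/measurable_EFinP; exact: measurable_funB.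
have gkn : (\int[@lebesgue_measure R]_t gk' (t + h n)%R <= (e / 3)%:E)%E.
  by rewrite (ge0_integral_shift (h n) gk').
have mgkn : measurable_fun [set: R] (fun t => gk' (t + h n)).
  by apply: (measurableT_comp mgk); exact: measurable_shift.
have mkn := measurable_translation_diff k (h n) mk.
rewrite [leRHS](_ : _ = (e / 3)%:E + ((e / 3)%:E + (e / 3)%:E))%E; last first.
  by rewrite -!EFinD; congr EFin; lra.
apply: le_trans (leeD gkn (leeD kn gk)).
rewrite -ge0_integralD//.
rewrite -ge0_integralD//; last 2 first.
- by move=> t _; exact: adde_ge0.
- exact: emeasurable_funD.
apply: ge0_le_integral => //.
- exact: measurable_translation_diff.
- by apply: emeasurable_funD => //; exact: emeasurable_funD.
move=> t _; rewrite /gk' !abse_EFin -!EFinD lee_fin.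
rewrite (le_trans (ler_distD (k (t + h n)) _ _))// lerD2l.
by rewrite (le_trans (ler_distD (k t) _ _))// lerD2l distrC.
Unshelve. all: by end_near. Qed.

(** * The conditional density and the joint law *)

Section conditional_density.
Context {d : measure_display} {T : measurableType d} {R : realType}.
Context {P : probability T R} (alpha beta : {RV P >-> R}).

(** The support is closed: its complement is the union of all null open sets. *)
Lemma measurable_rv_support : measurable (rv_support alpha).
Proof.
apply: closed_measurable; rewrite -openC.
suff -> : ~` rv_support alpha =
    \bigcup_(U in [set U : set R | open U /\ (distribution P alpha U <= 0)%E]) U.
  by apply: bigcup_open => U [].
apply/seteqP; split => [a|a [U [oU U0] Ua] /(_ U oU Ua)].
  move=> /existsNP[U] /not_implyP[oU] /not_implyP[Ua] /negP.
  by rewrite -leNgt => U0; exists U.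
by rewrite ltNge U0.
Qed.

Variable f : R -> R -> R.
Hypothesis fP : conditional_density alpha beta f.

(** Extending by 0 off the support, where [f] is arbitrary, gives a nonnegative function measurable
    on the whole plane. *)
Definition cond_pdf (p : R * R) : R :=
  ((fun p => f p.1 p.2) \_ (rv_support alpha `*` [set: R])) p.

Lemma cond_pdfE a t : cond_pdf (a, t) = if a \in rv_support alpha then f a t else 0.
Proof.
rewrite /cond_pdf patchE/=; congr (if _ then _ else _).
by apply/idP/idP; rewrite !inE; [case|split].
Qed.

Lemma measurable_cond_pdf : measurable_fun [set: R * R] cond_pdf.
Proof.
case: fP => mf _ _; apply: (measurable_restrictT _ _).1 => //.
by apply: measurableX => //; exact: measurable_rv_support.
Qed.

Lemma cond_pdf_ge0 p : 0 <= cond_pdf p.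
Proof.
case: p => a t; rewrite cond_pdfE; case: ifPn => // /[!inE] aE.
by case: fP => _ /(_ a aE)[].
Qed.

Lemma measurable_cond_pdf_section a :
  measurable_fun [set: R] (fun t => cond_pdf (a, t)).
Proof. exact: (measurableT_comp measurable_cond_pdf). Qed.

(** The integral is 1 on the support of [alpha] and 0 off it; the bound 1 is thus uniform in [a]. *)
Lemma integral_cond_pdf_le1 a :
  (\int[@lebesgue_measure R]_t (cond_pdf (a, t))%:E <= 1)%E.
Proof.
have [aE|/negbTE aE] := boolP (a \in rv_support alpha); last first.
  by under eq_integral do rewrite cond_pdfE aE; rewrite integral0.
under eq_integral do rewrite cond_pdfE aE.
by case: fP => _ /(_ a (set_mem aE))[_ _ ->].
Qed.

Lemma integrable_cond_pdf a :
  (@lebesgue_measure R).-integrable [set: R] (fun t => (cond_pdf (a, t))%:E).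
Proof.
apply/integrableP; split.
  by apply/measurable_EFinP; exact: measurable_cond_pdf_section.
have F0 t : (0 <= (cond_pdf (a, t))%:E)%E by rewrite lee_fin cond_pdf_ge0.
under eq_integral do rewrite (gee0_abs (F0 _)).
by rewrite (le_lt_trans (integral_cond_pdf_le1 a))// ltry.
Qed.

(** Tonelli turns the iterated integral of the disintegration into a density of the joint law with
    respect to the product measure. *)
Lemma joint_lawE (A : set (R * R)) : measurable A ->
  P [set w | A (alpha w, beta w)] =
  (\int[distribution P alpha \x @lebesgue_measure R]_(p in A) (cond_pdf p)%:E)%E.
Proof.
move=> mA; case: fP => _ _ ->//.
rewrite [RHS]integral_mkcond fubini_tonelli1; last 2 first.
- apply: (measurable_restrictT _ mA).1; apply: measurable_funTS.
  by apply/measurable_EFinP; exact: measurable_cond_pdf.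
- by move=> p; rewrite patchE; case: ifP => // _; rewrite lee_fin cond_pdf_ge0.
rewrite integral_mkcond; apply: eq_integral => a _; rewrite patchE.
rewrite /fubini_F; case: ifPn => aE; last first.
  rewrite integral0_eq// => t _; rewrite patchE cond_pdfE (negbTE aE).
  by case: ifP.
rewrite [LHS]integral_mkcond; apply: eq_integral => t _.
by rewrite !patchE cond_pdfE aE mem_xsection.
Qed.

(** Change of variables to the law of the pair, then its density [cond_pdf], then Tonelli back to an
    iterated integral. *)
Lemma ge0_integral_joint_law (phi : R * R -> \bar R) :
  measurable_fun [set: R * R] phi -> (forall p, (0 <= phi p)%E) ->
  (\int[P]_w phi (alpha w, beta w) =
   \int[distribution P alpha]_a \int[@lebesgue_measure R]_t
     (phi (a, t) * (cond_pdf (a, t))%:E))%E.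
Proof.
move=> mphi phi0.
(* [lebesgue_measure] lives on [measurableTypeR R], whose display is not that of
   [R], so the joint law is taken on [R * measurableTypeR R]. *)
pose ab : T -> R * measurableTypeR R := fun w => (alpha w, beta w).
have mab : measurable_fun [set: T] ab.
  have : measurable_fun [set: T] (fun w => (alpha w, beta w)).
    by apply: measurable_fun_pair.
  exact.
have mphi' : measurable_fun [set: R * measurableTypeR R] phi by exact: mphi.
have mF' : measurable_fun [set: R * measurableTypeR R] cond_pdf.
  exact: measurable_cond_pdf.
have := @ge0_integral_density _ _ R (distribution P alpha \x @lebesgue_measure R)%E
  (measure_function_pushforward__canonical__measure_function_Measure P mab)
  cond_pdf phi mF' cond_pdf_ge0 joint_lawE mphi' phi0.
rewrite (@ge0_integral_pushforward _ _ _ _ _ _ mab)// preimage_setT => ->.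
rewrite fubini_tonelli1//.
  by apply: emeasurable_funM => //; exact/measurable_EFinP.
by move=> p; rewrite mule_ge0// lee_fin cond_pdf_ge0.
Qed.

(** * The $L^1$ translation modulus averaged over the law of [alpha] *)

Definition translation_modulus (c : R) : \bar R :=
  (\int[distribution P alpha]_a \int[@lebesgue_measure R]_t
    `|(cond_pdf (a, t + c) - cond_pdf (a, t))%:E|)%E.

Lemma measurable_cond_pdf_shift (c : R) :
  measurable_fun [set: R * R] (fun p => cond_pdf (p.1, p.2 + c)).
Proof.
apply: (measurableT_comp measurable_cond_pdf).
apply: measurable_fun_pair => //.
by apply: (measurableT_comp (measurable_shift c)); exact: measurable_snd.
Qed.

Lemma measurable_section_modulus (c : R) :
  measurable_fun [set: R] (fun a => \int[@lebesgue_measure R]_t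
    `|(cond_pdf (a, t + c) - cond_pdf (a, t))%:E|)%E.
Proof.
have mF : measurable_fun [set: R * R]
    (fun p => `|(cond_pdf (p.1, p.2 + c) - cond_pdf p)%:E|%E).
  apply: measurable_abs_diff; first exact: measurable_cond_pdf_shift.
  exact: measurable_cond_pdf.
apply: (@measurable_fun_fubini_tonelli_F _ _ _ _ R (@lebesgue_measure R)
  (fun p : R * measurableTypeR R =>
     `|(cond_pdf (p.1, p.2 + c) - cond_pdf p)%:E|%E)).
  exact: mF.
by move=> p; exact: abse_ge0.
Qed.

(** Dominated convergence over [a]: each section tends to 0 by [cvg_translation_L1], and is at most
    2 because each of the two densities has mass at most 1. *)
Lemma cvg_translation_modulus (h : R^nat) : h @ \oo --> 0 ->
  translation_modulus (h n) @[n --> \oo] --> 0%E.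
Proof.
move=> h0.
have [] := @dominated_convergence _ _ _ (distribution P alpha) setT measurableT
  (fun n a => \int[@lebesgue_measure R]_t
    `|(cond_pdf (a, t + h n)%R - cond_pdf (a, t))%:E|)%E (cst 0%E) (EFin \o cst 2).
- by move=> n; exact: measurable_section_modulus.
- exact: measurable_cst.
- apply: aeW => a _; apply: (cvg_translation_L1 (fun t => cond_pdf (a, t)) h) => //.
  exact: integrable_cond_pdf.
- exact: finite_measure_integrable_cst.
- apply: aeW => a n _; rewrite gee0_abs; last exact: integral_ge0.
  have F0 t : (0 <= (cond_pdf (a, t))%:E)%E by rewrite lee_fin cond_pdf_ge0.
  have mF : measurable_fun [set: R] (fun t => (cond_pdf (a, t))%:E).
    by apply/measurable_EFinP; exact: measurable_cond_pdf_section.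
  have mFh : measurable_fun [set: R] (fun t => (cond_pdf (a, t + h n))%:E).
    by apply: (measurableT_comp mF); exact: measurable_shift.
  have Fh1 : (\int[@lebesgue_measure R]_t (cond_pdf (a, t + h n)%R)%:E <= 1)%E.
    rewrite (ge0_integral_shift (h n) (fun t => (cond_pdf (a, t))%:E))//.
    exact: integral_cond_pdf_le1.
  have -> : (EFin \o cst 2) a = (1 + 1)%E :> \bar R by rewrite -EFinD.
  apply: le_trans (leeD Fh1 (integral_cond_pdf_le1 a)).
  rewrite -ge0_integralD//; apply: ge0_le_integral => //.
  + by apply: measurable_translation_diff; exact: measurable_cond_pdf_section.
  + exact: emeasurable_funD.
  + move=> t _; rewrite abse_EFin -EFinD lee_fin (le_trans (ler_normB _ _))//.
    by rewrite !ger0_norm ?cond_pdf_ge0.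
- by move=> _ _; rewrite integral0.
Qed.

(* The shift [c] is moved from [Y] onto the density by translation invariance of
   Lebesgue measure. *)
Lemma expectation_shift_le (Y : R -> R) (M x c : R) :
  measurable_fun [set: R] Y -> (forall z, 0 <= Y z <= M) ->
  (\int[P]_w (Y (alpha w * (x + c - beta w)))%:E <=
   \int[P]_w (Y (alpha w * (x - beta w)))%:E + M%:E * translation_modulus c)%E.
Proof.
move=> mY YM.
have Y0 z : (0 <= (Y z)%:E)%E by rewrite lee_fin; case/andP: (YM z).
have M0 : 0 <= M by case/andP: (YM 0) => /le_trans; exact.
have mphi b : measurable_fun [set: R * R] (fun p => (Y (p.1 * (b - p.2)))%:E).
  apply/measurable_EFinP; apply: (measurableT_comp mY).
  apply: measurable_funM; first exact: measurable_fst.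
  by apply: measurable_funB; [exact: measurable_cst|exact: measurable_snd].
have F0 p : (0 <= (cond_pdf p)%:E)%E by rewrite lee_fin cond_pdf_ge0.
have lawE b := ge0_integral_joint_law (fun p => (Y (p.1 * (b - p.2)))%:E)
  (mphi b) (fun p => Y0 _).
rewrite (lawE (x + c)) (lawE x) /translation_modulus /=.
have mG b : measurable_fun [set: R * R]
    (fun p => (Y (p.1 * (b - p.2)))%:E * (cond_pdf p)%:E)%E.
  apply: emeasurable_funM; first exact: mphi.
  by apply/measurable_EFinP; exact: measurable_cond_pdf.
have mGa b a : measurable_fun [set: R]
    (fun t => (Y (a * (b - t)))%:E * (cond_pdf (a, t))%:E)%E.
  exact: (measurable_fun_pair2 a (mG b)).
have G0 b a t : (0 <= (Y (a * (b - t)))%:E * (cond_pdf (a, t))%:E)%E.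
  by rewrite mule_ge0.
have mGint b : measurable_fun [set: R] (fun a => \int[@lebesgue_measure R]_t
    ((Y (a * (b - t)%R))%:E * (cond_pdf (a, t))%:E))%E.
  apply: (@measurable_fun_fubini_tonelli_F _ _ _ _ R (@lebesgue_measure R)
    (fun p : R * measurableTypeR R =>
      ((Y (p.1 * (b - p.2)))%:E * (cond_pdf p)%:E)%E)).
  - exact: mG.
  - by case=> a t; exact: G0.
(* The right side is gathered into a single integral over [a], so that the inequality can be proved
   for each [a] separately. *)
rewrite -ge0_integralZl//; last 2 first.
- exact: measurable_section_modulus.
- by move=> a _; exact: integral_ge0.
rewrite -ge0_integralD//; last 3 first.
- by move=> a _; exact: integral_ge0.
- by move=> a _; rewrite mule_ge0//; exact: integral_ge0.
- by apply: measurable_funeM; exact: measurable_section_modulus.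
apply: ge0_le_integral => //.
- by move=> a _; exact: integral_ge0.
- by apply: emeasurable_funD => //; apply: measurable_funeM;
    exact: measurable_section_modulus.
move=> a _.
have mD := measurable_translation_diff (fun t => cond_pdf (a, t)) c
  (measurable_cond_pdf_section a).
rewrite -(ge0_integral_shift c)//.
rewrite -ge0_integralZl// -ge0_integralD//; last 3 first.
- exact: mGa.
- by move=> t _; rewrite mule_ge0.
- exact: measurable_funeM.
apply: ge0_le_integral => //.
- by apply: (measurableT_comp (mGa (x + c) a)); exact: measurable_shift.
- by apply: emeasurable_funD; [exact: mGa|exact: measurable_funeM].
(* After the shift [Y] is evaluated at the same point [a * (x - t)] on both sides; what remains is
   [Y] times the difference of densities, bounded by means of [0 <= Y <= M]. *)
move=> t _; rewrite -!EFinM -EFinD lee_fin.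
rewrite (_ : x + c - (t + c) = x - t); last by lra.
have /andP[? ?] := YM (a * (x - t)).
rewrite -lerBlDl -mulrBr (le_trans (ler_norm _))// normrM.
by rewrite ler_wpM2r// ger0_norm.
Qed.

End conditional_density.

(** * Uniform continuity of bounded solutions *)

Theorem theorem3p3 (R : realType) (d : measure_display)
    (T : measurableType d) (P : probability T R)
    (alpha beta : {RV P >-> R})
    (alpha_neq0 : P [set w | alpha w != 0] = 1%E)
    (norm_alpha_neq1 : (0 < P [set w | (`|alpha w| != 1)%R])%E)
    (nondegenerate :
      ~ exists c : R, {ae P, forall w, alpha w * (c - beta w) = c})
    (density : exists f : R -> R -> R, conditional_density alpha beta f)
    (y : R -> R)
    (y_measurable : measurable_fun [set: R] y)
    (y_bounded : bounded_fun y)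
    (y_eq : forall x : R,
      ((y x)%:E = 'E_P[fun w => y (alpha w * (x - beta w))%R])%E) :
  unif_continuous y.
Proof.
have [f fP] := density.
have [M M0 yM] : exists2 M : R, 0 < M & forall z, `|y z| <= M.
  by have /pinfty_ex_gt0[M M0 yM] := y_bounded; exists M => // z; exact: yM.
(* Adding [M] keeps every integral below nonnegative. *)
pose Y z := y z + M.
have mY : measurable_fun [set: R] Y by exact: measurable_funD.
have YM z : 0 <= Y z <= M + M.
  by have := yM z; rewrite ler_norml /Y => /andP[? ?]; apply/andP; split; lra.
(* Adding a constant preserves the equation because [P] has total mass 1. *)
have Y_eq x : ((Y x)%:E = \int[P]_w (Y (alpha w * (x - beta w)))%:E)%E.
  rewrite /Y EFinD y_eq unlock.
  under [RHS]eq_integral do rewrite EFinD.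
  rewrite integralD//.
  - by congr (_ + _)%E; rewrite integral_cst//= probability_setT mule1.
  - apply: (@measurable_bounded_integrable _ _ _ P
      (fun w => y (alpha w * (x - beta w))) setT) => //.
    + by rewrite (le_lt_trans (probability_le1 _ _))// ltry.
    + apply: (measurableT_comp y_measurable); apply: measurable_funM => //.
      exact: measurable_funB.
    + exists M; split; first exact: num_real.
      by move=> N MN w _ /=; rewrite (le_trans (yM _))// ltW.
  - exact: finite_measure_integrable_cst.
have Y_shift x c : ((Y (x + c))%:E <=
    (Y x)%:E + (M + M)%:E * translation_modulus alpha f c)%E.
  by rewrite !Y_eq; exact: (expectation_shift_le _ _ _ fP).
apply/unif_continuousP => e e0; apply: contrapT => ye.
(* If uniform continuity fails at [e], there are arbitrarily close points whose values differ by at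
   least [e]. Each pair is ordered with the larger value second, so the one-sided bound [Y_shift] is
   enough. *)
have far n : exists p : R * R,
    `|p.2 - p.1| < n.+1%:R^-1 /\ y p.1 + e <= y p.2.
  apply: contrapT => /forallNP near_y; apply: ye.
  exists n.+1%:R^-1; first by rewrite invr_gt0.
  case=> a b; rewrite -!ball_normE/= => ab; rewrite ltNge; apply/negP.
  rewrite ler_normr => /orP[ey|ey].
    by apply: (near_y (b, a)); split => //=; lra.
  by apply: (near_y (a, b)); rewrite distrC; split => //=; lra.
have [p pP] := choice far.
pose h n := (p n).2 - (p n).1.
have h0 : h @ \oo --> 0.
  apply/norm_cvg0P.
  apply: (@squeeze_cvgr _ _ _ _ (cst 0) harmonic); last 2 first.
  - exact: cvg_cst.
  - exact: cvg_harmonic.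
  by apply: nearW => n; rewrite normr_ge0/= ltW//; case: (pP n).
(* Multiplied by the bound [M + M] of [Y], this threshold gives [e / 2], which contradicts a gap of
   at least [e]. *)
have e40 : 0 < e / (4 * M) by rewrite divr_gt0// mulr_gt0.
have W0 c : (0 <= translation_modulus alpha f c)%E.
  by apply: integral_ge0 => a _; exact: integral_ge0.
have := cvg_translation_modulus alpha beta f fP h h0.
rewrite cvge_to0P// => /(_ _ e40)[n _ /(_ n (leqnn n))/= Wn].
have [_ yp] := pP n; have := Y_shift (p n).1 (h n).
rewrite /h addrC subrK => Yp.
have : ((Y (p n).2)%:E <= (Y (p n).1)%:E + (M + M)%:E * (e / (4 * M))%:E)%E.
  by apply: (le_trans Yp); rewrite leeD2l// lee_wpmul2l// lee_fin addr_ge0// ltW.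
rewrite -EFinM -EFinD lee_fin /Y.
have -> : (M + M) * (e / (4 * M)) = e / 2 by field; rewrite gt_eqF.
move: yp; clear - e0; lra.
Qed.
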